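(* The formal power series $$P(z,u,v_1,v_2,v_3)=\sum_{n,k,a,b,c\ge 0}p_{n,k;a,b,c}\,z^nu^kv_1^av_2^bv_3^c$$ satisfies \begin{align*} P(z,u,v_1,v_2,v_3)&=1+zuv_1v_2v_3+z^2uv_1v_2v_3^2\\ &\quad+\frac{zuv_1v_2v_3}{1-v_1v_2v_3}\Big(1-\frac{zv_1v_2v_3}{1-v_1v_2}\Big)\big(P(z,u,v_1v_2v_3,1,1)-P(z,u,1,1,v_1v_2v_3)\big)\\ &\quad+\frac{z^2uv_1v_2v_3^2}{(1-v_1v_2)(1-v_3)}\big(P(z,u,v_3,1,1)-P(z,u,1,1,v_1v_2v_3)\big)\\ &\quad+\frac{z^2uv_1v_2v_3^3}{(1-v_1v_2)(1-v_3)}\big(P(zv_3,u,1,1,v_1v_2)-P(zv_3,u,1,1,1)\big)\\ &\quad+\frac{zv_2v_3}{1-v_2}\big(P(z,u,v_1,v_2,v_3)-P(z,u,v_1,1,v_2v_3)\big). \end{align*}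
   Context: Runs of a permutation are its maximal increasing strings of consecutive entries; falls are its maximal decreasing strings of consecutive entries. The flip $T$ reverses every fall in place; a permutation is pop-stacked if it lies in the image of $T$ (equivalently, every pair of adjacent runs $(R_i,R_{i+1})$ satisfies $\min(R_i)<\max(R_{i+1})$). For integers $n\ge1$, $k$, and $1\le a\le b\le c\le n$, $p_{n,k;a,b,c}$ is the number of pop-stacked permutations of size $n$ with exactly $k$ runs whose last run has smallest element $a$ and largest element $c$, and where $b$ is the second-largest element of the last run if $a<c$, and $b=a=c$ if $a=c$. The empty permutation contributes the term $1$ (i.e. $p_{0,0;0,0,0}=1$), and $p_{n,k;a,b,c}=0$ for all other index tuples. *)

(* Defs.v *)
From HB Require Import structures.
From mathcomp Require Import all_boot all_order all_algebra all_fingroup.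
From mathcomp Require Import boolp classical_sets fsbigop.
From mathcomp Require Import mpoly.

Set Implicit Arguments.
Unset Strict Implicit.
Unset Printing Implicit Defensive.

Import GRing.Theory.

Local Open Scope ring_scope.

(* Formal power series in n variables over R, given by their coefficients;   *)
(* the coefficient of f at the monomial m is written f m.                    *)
Record mfps (n : nat) (R : Type) := Mfps { mfps_coef :> 'X_{1..n} -> R }.

HB.instance Definition _ n R := gen_eqMixin (mfps n R).
HB.instance Definition _ n R := gen_choiceMixin (mfps n R).

Lemma mfpsP n R (f g : mfps n R) : f =1 g -> f = g.
Proof. by case: f g => [f] [g] /= /funext ->. Qed.

Section MfpsRing.
Variables (n : nat) (R : comNzRingType).
Implicit Types (f g h : mfps n R) (m : 'X_{1..n}) (d : nat).

Definition mfps0 : mfps n R := Mfps (fun=> 0).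
Definition mfps1 : mfps n R := Mfps (fun m => (m == 0%MM)%:R).
Definition mfps_add f g : mfps n R := Mfps (fun m => f m + g m).
Definition mfps_opp f : mfps n R := Mfps (fun m => - f m).
Definition mfps_mul f g : mfps n R :=
  Mfps (fun m =>
    \sum_(k : 'X_{1..n < (mdeg m).+1, (mdeg m).+1} | m == (k.1 + k.2)%MM)
      f k.1 * g k.2).

Fact mfps_addA : associative mfps_add.
Proof. by move=> f g h; apply: mfpsP => m /=; rewrite addrA. Qed.
Fact mfps_addC : commutative mfps_add.
Proof. by move=> f g; apply: mfpsP => m /=; rewrite addrC. Qed.
Fact mfps_add0 : left_id mfps0 mfps_add.
Proof. by move=> f; apply: mfpsP => m /=; rewrite add0r. Qed.
Fact mfps_addN : left_inverse mfps0 mfps_opp mfps_add.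
Proof. by move=> f; apply: mfpsP => m /=; rewrite addNr. Qed.

HB.instance Definition _ := GRing.isZmodule.Build (mfps n R)
  mfps_addA mfps_addC mfps_add0 mfps_addN.

Definition mfps_trunc d f : {mpoly R[n]} :=
  \sum_(m : 'X_{1..n < d}) f m *: 'X_[m].

Lemma mcoeff_trunc d f m : (mdeg m < d)%N -> (mfps_trunc d f)@_m = f m.
Proof.
move=> ltmd; rewrite /mfps_trunc raddf_sum /= (bigD1 (BMultinom ltmd)) //=.
rewrite mcoeffZ mcoeffX eqxx mulr1 big1 ?addr0 // => k nek.
rewrite mcoeffZ mcoeffX; case: eqP => [ekm|]; last by rewrite mulr0.
by case/eqP: nek; apply: val_inj.
Qed.

Lemma mcoeffM_trunc (p p' q q' : {mpoly R[n]}) d :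
  (forall m, (mdeg m < d)%N -> p@_m = p'@_m) ->
  (forall m, (mdeg m < d)%N -> q@_m = q'@_m) ->
  forall m, (mdeg m < d)%N -> (p * q)@_m = (p' * q')@_m.
Proof.
move=> ep eq m ltmd; rewrite !mcoeffM; apply: eq_bigr => -[k1 k2] /= _.
by rewrite ep ?eq //; apply: leq_trans ltmd; apply: bmdeg.
Qed.

Lemma mfps_mulE d f g m : (mdeg m < d)%N ->
  mfps_mul f g m = (mfps_trunc d f * mfps_trunc d g)@_m.
Proof.
move=> ltmd; rewrite mcoeffM /=; apply: eq_bigr => -[k1 k2] /= _.
by rewrite !mcoeff_trunc //; apply: leq_trans ltmd; apply: bmdeg.
Qed.

Fact mfps_mulA : associative mfps_mul.
Proof.
move=> f g h; apply: mfpsP => m; set d := (mdeg m).+1.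
rewrite !(@mfps_mulE d) //.
transitivity ((mfps_trunc d f * (mfps_trunc d g * mfps_trunc d h))@_m).
  apply: (@mcoeffM_trunc _ _ _ _ d) => // k ltkd.
  by rewrite mcoeff_trunc // (@mfps_mulE d).
rewrite mulrA; apply: (@mcoeffM_trunc _ _ _ _ d) => // k ltkd.
by rewrite mcoeff_trunc // (@mfps_mulE d).
Qed.

Fact mfps_mulC : commutative mfps_mul.
Proof.
by move=> f g; apply: mfpsP => m; rewrite !(@mfps_mulE (mdeg m).+1) // mulrC.
Qed.

Fact mfps_mul1 : left_id mfps1 mfps_mul.
Proof.
move=> f; apply: mfpsP => m; set d := (mdeg m).+1.
rewrite (@mfps_mulE d) // -[RHS](@mcoeff_trunc d) // -[in RHS](mul1r (mfps_trunc _ _)).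
apply: (@mcoeffM_trunc _ _ _ _ d) => // k ltkd.
by rewrite mcoeff_trunc // mcoeff1.
Qed.

Fact mfps_mulDl : left_distributive mfps_mul mfps_add.
Proof.
move=> f g h; apply: mfpsP => m /=.
by rewrite -big_split; apply: eq_bigr => k _; rewrite /= mulrDl.
Qed.

Fact mfps1_neq0 : mfps1 != 0.
Proof.
apply/eqP => /(congr1 (fun f : mfps n R => f 0%MM)) /= /eqP.
by rewrite eqxx oner_eq0.
Qed.

HB.instance Definition _ := GRing.Zmodule_isComNzRing.Build (mfps n R)
  mfps_mulA mfps_mulC mfps_mul1 mfps_mulDl mfps1_neq0.

Lemma mfps_coef1 m : (1 : mfps n R) m = (m == 0%MM)%:R. Proof. by []. Qed.
Lemma mfps_coefD f g m : (f + g) m = f m + g m. Proof. by []. Qed.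
Lemma mfps_coefN f m : (- f) m = - f m. Proof. by []. Qed.
Lemma mfps_coefM f g m : (f * g) m =
  \sum_(k : 'X_{1..n < (mdeg m).+1, (mdeg m).+1} | m == (k.1 + k.2)%MM)
    f k.1 * g k.2.
Proof. by []. Qed.
Lemma mfps_coef_sum I (r : seq I) (P : pred I) (F : I -> mfps n R) m :
  (\sum_(i <- r | P i) F i) m = \sum_(i <- r | P i) F i m.
Proof. exact: (big_morph (fun f : mfps n R => f m)). Qed.

Definition mfpsC (c : R) : mfps n R := Mfps (fun m => c *+ (m == 0%MM)).

Definition mfpsX (i : 'I_n) : mfps n R := Mfps (fun m => (m == U_(i)%MM)%:R).

Lemma mfps_coefCM c f m : (mfpsC c * f) m = c * f m.
Proof.
rewrite mfps_coefM.
have h0 : (mdeg (0%MM : 'X_{1..n}) < (mdeg m).+1)%N by rewrite mdeg0.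
have hm : (mdeg m < (mdeg m).+1)%N by [].
rewrite (bigD1 (BMultinom h0, BMultinom hm)) /=; last by rewrite add0m.
rewrite eqxx big1 ?addr0 // => -[k1 k2] /= /andP[/eqP em ne].
case: eqP => [k10|]; last by rewrite mul0r.
case/eqP: ne; congr (_, _); apply: val_inj => //=.
by move: em; rewrite k10 add0m => /esym.
Qed.

Lemma mfps_coefM0 f g : (f * g) 0%MM = f 0%MM * g 0%MM.
Proof.
rewrite mfps_coefM.
have h0 : (mdeg (0%MM : 'X_{1..n}) < (mdeg (0%MM : 'X_{1..n})).+1)%N by [].
rewrite (bigD1 (BMultinom h0, BMultinom h0)) /=; last by rewrite add0m.
have k0 (k : 'X_{1..n < (mdeg (0%MM : 'X_{1..n})).+1}) : k = BMultinom h0.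
  apply: val_inj; apply/eqP; rewrite /= -mdeg_eq0 -leqn0.
  by have := bmdeg k; rewrite ltnS [X in (_ <= X)%N -> _]mdeg0.
rewrite big1 ?addr0 // => -[k1 k2] /= /andP[_ /eqP[]].
by rewrite (k0 k1) (k0 k2).
Qed.

Lemma mfps_coefX_small f d m :
  f 0%MM = 0 -> (mdeg m < d)%N -> (f ^+ d) m = 0.
Proof.
move=> f0; elim: d m => [|d IHd] m; first by [].
move=> ltmd; rewrite exprS mfps_coefM big1 // => -[k1 k2] /= /eqP em.
have [->|nz] := eqVneq (k1 : 'X_{1..n}) 0%MM; first by rewrite f0 mul0r.
rewrite IHd ?mulr0 //; apply: leq_trans (_ : mdeg m <= d)%N => //.
by rewrite [X in (_ <= mdeg X)%N]em mdegD -add1n leq_add2r lt0n mdeg_eq0.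
Qed.

End MfpsRing.

Arguments mfpsX {n R} i.

Section MfpsUnit.
Variables (n : nat) (R : comUnitRingType).
Implicit Types (f g : mfps n R).

Definition mfps_unit : pred (mfps n R) := fun f => f 0%MM \is a GRing.unit.

(* The geometric series c^-1 * \sum_j (1 - c^-1 * f)^j, with c = f 0 the     *)
(* constant coefficient; only the terms with j <= mdeg m contribute at m.    *)
Definition mfps_inv f : mfps n R :=
  if mfps_unit f then
    let c := mfpsC n (f 0%MM)^-1 in
    c * Mfps (fun m => \sum_(j < (mdeg m).+1) ((1 - c * f) ^+ j) m)
  else f.

Fact mfps_mulV : {in mfps_unit, left_inverse 1 mfps_inv *%R}.
Proof.
move=> f; rewrite unfold_in => fU; rewrite /mfps_inv /mfps_unit fU.
set c := mfpsC _ _; set g := 1 - c * f; set s := Mfps _.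
have g0 : g 0%MM = 0.
  by rewrite mfps_coefD mfps_coefN mfps_coefCM mfps_coef1 eqxx mulVr ?subrr.
rewrite mulrAC; have -> : c * f = 1 - g by rewrite /g opprB addrC subrK.
apply: mfpsP => m; set d := (mdeg m).+1.
transitivity (((1 - g) * \sum_(j < d) g ^+ j) m).
  rewrite !mfps_coefM; apply: eq_bigr => -[k1 k2] /= _; congr (_ * _).
  rewrite mfps_coef_sum (big_ord_widen d (fun j => (g ^+ j) k2)) ?bmdeg //.
  rewrite big_mkcond; apply: eq_bigr => j _; case: ltnP => // ltkj.
  by rewrite mfps_coefX_small.
have -> : (1 - g) * \sum_(j < d) g ^+ j = 1 - g ^+ d.
  by rewrite -opprB mulNr -subrX1 opprB.
by rewrite mfps_coefD mfps_coefN mfps_coefX_small // subr0.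
Qed.

Fact mfps_unitP f g : g * f = 1 -> mfps_unit f.
Proof.
move/(congr1 (fun h : mfps n R => h 0%MM)); rewrite mfps_coefM0 mfps_coef1 eqxx.
by move=> e; apply/unitrPr; exists (g 0%MM); rewrite mulrC.
Qed.

Fact mfps_inv_out : {in [predC mfps_unit], mfps_inv =1 id}.
Proof. by move=> f; rewrite inE unfold_in /mfps_inv /mfps_unit => /negbTE ->. Qed.

HB.instance Definition _ := GRing.ComNzRing_hasMulInverse.Build (mfps n R)
  mfps_mulV mfps_unitP mfps_inv_out.

End MfpsUnit.

(* Substitution F(x_0, ..., x_(n-1)), computed coefficientwise. The sum over *)
(* all exponents e is the finitely supported sum: it is meaningful whenever, *)
(* for each m, only finitely many terms are nonzero (so x may contain 1 at   *)
(* places where F is polynomial), and is 0 by convention otherwise.          *)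
Definition mfps_subst (n k : nat) (R : comNzRingType)
    (F : mfps n R) (x : n.-tuple (mfps k R)) : mfps k R :=
  Mfps (fun m => \sum_(e \in [set: 'X_{1..n}]%classic)
                   F e * (\prod_(i < n) tnth x i ^+ e i) m).

Section MfpsSubstId.
Variables (n : nat) (R : comNzRingType).

Definition mfps_mon (e : 'X_{1..n}) : mfps n R := Mfps (fun m => (m == e)%:R).

Lemma mfps_monD (e1 e2 : 'X_{1..n}) :
  mfps_mon (e1 + e2)%MM = mfps_mon e1 * mfps_mon e2.
Proof.
apply: mfpsP => m; set d := (mdeg m).+1.
rewrite [RHS](@mfps_mulE _ _ d) //=.
transitivity (('X_[e1] * 'X_[e2] : {mpoly R[n]})@_m).
  by rewrite -mpolyXD mcoeffX eq_sym.
by apply: (@mcoeffM_trunc _ _ _ _ _ _ d) => // k ltkd;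
  rewrite mcoeff_trunc // mcoeffX eq_sym.
Qed.

Lemma mfps_mon0 : mfps_mon 0%MM = 1. Proof. by []. Qed.

Lemma mfps_prodX (e : 'X_{1..n}) :
  \prod_(i < n) (mfpsX i : mfps n R) ^+ e i = mfps_mon e.
Proof.
rewrite [e in RHS]multinomUE_id.
rewrite (big_morph mfps_mon mfps_monD mfps_mon0); apply: eq_bigr => i _.
elim: (e i) => [|j IHj]; first by rewrite mulm0n expr0 mfps_mon0.
by rewrite mulmS mfps_monD exprS IHj.
Qed.

Lemma mfps_subst_id (F : mfps n R) :
  mfps_subst F [tuple mfpsX i | i < n] = F.
Proof.
apply: mfpsP => m; rewrite /mfps_subst /=.
rewrite -(fsbig_widen [set m]%classic) => [||e [_ /= nem]] //.
  rewrite fsbig_set1 (eq_bigr (fun i => mfpsX i ^+ m i)) => [|i _].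
    by rewrite mfps_prodX /= eqxx mulr1.
  by rewrite tnth_mktuple.
rewrite (eq_bigr (fun i => mfpsX i ^+ e i)) => [|i _].
  by rewrite mfps_prodX /=; case: eqP => [/esym/nem|_] //; rewrite mulr0.
by rewrite tnth_mktuple.
Qed.

End MfpsSubstId.

(* The maximal strings of consecutive entries of s in which every entry is   *)
(* related by r to the next one.                                             *)
Fixpoint blocks (r : rel nat) (s : seq nat) : seq (seq nat) :=
  if s is x :: s' then
    if blocks r s' is b :: bs then
      if r x (head x b) then (x :: b) :: bs else [:: x] :: b :: bs
    else [:: [:: x]]
  else [::].

Definition runs (s : seq nat) : seq (seq nat) := blocks ltn s.
Definition falls (s : seq nat) : seq (seq nat) := blocks gtn s.

Definition flip (s : seq nat) : seq nat := flatten (map rev (falls s)).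

(* One-line notation, with entries 1, ..., n. *)
Definition word (n : nat) (s : 'S_n) : seq nat :=
  [seq (s i).+1 | i <- enum 'I_n].

Definition pop_stacked (n : nat) (s : 'S_n) : bool :=
  [exists t : 'S_n, flip (word t) == word s].

Definition is_min (a : nat) (s : seq nat) : bool :=
  (a \in s) && all (fun x => a <= x)%N s.
Definition is_max (c : nat) (s : seq nat) : bool :=
  (c \in s) && all (fun x => x <= c)%N s.

Definition last_run (s : seq nat) : seq nat := last [::] (runs s).

Definition run_stats (r : seq nat) (a b c : nat) : bool :=
  [&& is_min a r, is_max c r &
      if (a < c)%N then is_max b (rem c r) else b == a].

Definition p_coef (n k a b c : nat) : nat :=
  if n is 0 then [&& k == 0%N, a == 0%N, b == 0%N & c == 0%N]
  else #|[set s : 'S_n | [&& pop_stacked s, size (runs (word s)) == k &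
                             run_stats (last_run (word s)) a b c]]|.

(* The variables, in order, are z, u, v1, v2, v3. *)
Definition P_series : mfps 5 int :=
  Mfps (fun e => (p_coef (e (inord 0)) (e (inord 1)) (e (inord 2))
                         (e (inord 3)) (e (inord 4)))%:Z).

Definition P (z u v1 v2 v3 : mfps 5 int) : mfps 5 int :=
  mfps_subst P_series [tuple z; u; v1; v2; v3].

Lemma P_variables :
  P (mfpsX (inord 0)) (mfpsX (inord 1)) (mfpsX (inord 2)) (mfpsX (inord 3))
    (mfpsX (inord 4)) = P_series.
Proof.
rewrite -[RHS]mfps_subst_id /P; congr mfps_subst; apply: eq_from_tnth => i.
rewrite tnth_mktuple; case: i => -[|[|[|[|[|//]]]]] h;
  by rewrite (tnth_nth 0) /=; congr mfpsX; apply: val_inj; rewrite /= inordK.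
Qed.

(* Main.v *)
Require Import Defs.
From mathcomp Require Import all_boot all_order all_algebra all_fingroup.
From mathcomp Require Import boolp classical_sets fsbigop.
From mathcomp Require Import mpoly zify ring.

(* A permutation is pop-stacked iff head R < last R' for any two adjacent     *)
(* runs R, R': reversed falls can only merge into longer runs, and reversing  *)
(* every run of such a permutation gives a preimage under the flip.           *)
(*   Every word of size n + 1 arises from a unique word of size n by          *)
(* appending a letter x and raising the letters >= x by one, and the run      *)
(* statistics change in a way that depends only on x and on the statistics.   *)
(* Let (a', b', c') be the statistics of the permutation left by the          *)
(* following removals:                                                        *)
(* - if the last run is a single letter x, remove it: a' < x <= c';           *)
(* - if it has two letters b < c, remove both: b <= c' and c > a' + 1;        *)
(* - otherwise remove its second largest letter b: b' < b <= c' = c - 1.      *)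
(* Summing the resulting geometric series gives the equation.                 *)

Set Implicit Arguments.
Unset Strict Implicit.
Unset Printing Implicit Defensive.

Import GRing.Theory.

(** * Runs and pop-stacked permutations *)

(** For each size n let F_n(A, B, C) be the sum of u^k A^a B^b C^c over the pop-stacked permutations
    of size n. [pop_stackedE] makes being pop-stacked a condition on adjacent runs, and
    [state_of_append] shows that a small state suffices to follow it while letters are appended on
    the right.

    Each shape of the last run then gives a geometric sum over the removed letters. Put W = ABC. A
    single letter x contributes W^x for a' < x <= c', which sums to W (W^a' - W^c') / (1 - W) and so
    produces F(W, 1, 1) - F(1, 1, W): [singleton_partE]. Two letters give a double sum,
    [pair_partE]; its upper limit depends on the size, which leaves a factor C^n and is the source
    of the argument z v3. Three or more letters give F(A, B, C) - F(A, 1, BC): [long_partE].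

    The resulting recursion [word_poly_rec] expresses F_(n+2) through F_(n+1) and F_n. Multiplying
    by powers of z and summing, with [mfps_substE] to read P as a sum over sizes, yields the
    equation; the sizes 0, 1 and 2 supply its explicit terms. *)

Section Blocks.
Variable r : rel nat.
Implicit Types (s b : seq nat) (bs : seq (seq nat)).

Lemma flatten_blocks s : flatten (blocks r s) = s.
Proof.
elim: s => //= x s IHs; case: (blocks r s) IHs => [|b bs] /= <- //.
by case: ifP.
Qed.

Lemma blocks_nonempty s : all (fun b => b != [::]) (blocks r s).
Proof.
elim: s => //= x s; case: (blocks r s) => [|b bs] //=.
by case: ifP => //= _ /andP[].
Qed.

Lemma blocks_eq0 s : (blocks r s == [::]) = (s == [::]).
Proof. by case: s => //= x s; case: (blocks r s) => [|b bs] //; case: ifP. Qed.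

Lemma blocks_sorted s : all (sorted r) (blocks r s).
Proof.
elim: s => //= x s; case: (blocks r s) => [|b bs] //=.
case: ifP => //= rxb /andP[sb ->]; rewrite andbT.
by case: b sb rxb => //= y b -> ->.
Qed.

Lemma blocks_adjacent s :
  sorted (fun b b' => ~~ r (last 0 b) (head 0 b')) (blocks r s).
Proof.
elim: s => //= x s; have := blocks_nonempty s.
case: (blocks r s) => [|b bs] //= /andP[nb _]; case: b nb => // y b _ /=.
case: ifP => [_|/negbT nrxy]; first by case: bs.
by case: bs => [|b' bs] /=; rewrite nrxy.
Qed.

(** These three properties characterise the decomposition into blocks, so that runs and falls can be
    recognised without recursing through the word. *)
Lemma blocks_flatten bs :
  all (fun b => b != [::]) bs -> all (sorted r) bs ->
  sorted (fun b b' => ~~ r (last 0 b) (head 0 b')) bs ->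
  blocks r (flatten bs) = bs.
Proof.
elim: bs => //= -[//|x b] bs IHbs /= nbs /andP[sb sbs] pbs.
have {IHbs} eqbs : blocks r (flatten bs) = bs.
  by apply: IHbs => //; apply: path_sorted pbs.
elim: b x sb pbs => [|y b IHb] x /= sb pbs; last first.
  case/andP: sb => rxy sb; rewrite IHb //= ?rxy //.
  by case: (bs) pbs.
rewrite eqbs; case: bs nbs pbs {sbs eqbs} => //= -[//|y b'] bs _ /=.
by case/andP=> /negbTE ->.
Qed.

(** [blocks] recurses from the front, whereas permutations are built at the back; only the last
    block sees the new letter. *)
Lemma blocks_rcons s x b bs : blocks r s = rcons bs b ->
  blocks r (rcons s x) =
    if r (last 0 b) x then rcons bs (rcons b x) else rcons (rcons bs b) [:: x].
Proof.
elim: s b bs => [|y s IHs] b bs /=; first by case: bs.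
case: (lastP (blocks r s)) (IHs) (blocks_nonempty s) (blocks_eq0 s).
  move=> _ _; rewrite eqxx => /esym/eqP -> /=.
  case: bs => [[<-]|b' bs] /=; last by case: bs.
  by case: ifP.
move=> bs' b' /(_ b' bs' erefl) -> nb _.
case: bs' nb => [|b0 bs'] /=; rewrite ?andbT => nb.
  case: b' nb => // y' b' _ /=; case: ifP => ryy'.
    case: bs => [|b1 bs] [] //=; last by case: bs.
    by move=> <- /=; case: ifP => //=; rewrite ryy'.
  case: bs => [|b1 [|b2 bs]] [] //=; last by case: bs.
  by move=> <- <- /=; case: ifP => //=; rewrite ryy'.
case: b0 nb => // y0 b0 /=  _; case: ifP => ryy0.
  case: bs => [|b1 bs] [] //=; first by case: bs'.
  move=> <- /eqP; rewrite eqseq_rcons => /andP[/eqP <- /eqP <-].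
  by case: ifP => /=; rewrite ryy0.
case: bs => [|b1 [|b2 bs]] [] //=; first by case: bs'.
move=> <- <- /eqP; rewrite eqseq_rcons => /andP[/eqP <- /eqP <-].
by case: ifP => /=; rewrite ryy0.
Qed.

Lemma blocks_map (f : nat -> nat) s :
  (forall x y, r (f x) (f y) = r x y) ->
  blocks r (map f s) = map (map f) (blocks r s).
Proof.
move=> rf; elim: s => //= x s ->.
have := blocks_nonempty s; case: (blocks r s) => [|[|y b] bs] //= _.
by rewrite rf; case: ifP.
Qed.

End Blocks.

(** * Overlapping runs and the image of the flip *)

Definition run_overlap (R R' : seq nat) : bool := head 0 R < last 0 R'.

Lemma sorted_ltn_head_last (x : nat) s : sorted ltn (x :: s) -> x <= last x s.
Proof.
elim: s x => //= y s IHs x /andP[xy ys].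
by apply: leq_trans (IHs y ys); apply: ltnW.
Qed.

Lemma runs_cat_sorted g s R rs :
  g != [::] -> sorted ltn g -> runs s = R :: rs ->
  runs (g ++ s) =
    if last 0 g < head 0 R then (g ++ R) :: rs else g :: R :: rs.
Proof.
move=> + + eqR; have nR: R != [::].
  by have := blocks_nonempty ltn s; rewrite -/(runs s) eqR => /andP[].
case: R nR eqR => // y R _ eqR; case: g => // x g _.
elim: g x => [|x' g IHg] x /=.
  by move=> _; rewrite /runs in eqR *; rewrite /= eqR /=; case: ifP.
case/andP=> xx' sg; rewrite /runs /=.
move: (IHg x' sg); rewrite /runs /= => ->.
by case: ifP => /=; rewrite xx'.
Qed.

(* Each run of [flatten gs] is a union of consecutive members of [gs]. *)
Lemma runs_overlap_flatten g gs :
  all (fun g => g != [::]) (g :: gs) -> all (sorted ltn) (g :: gs) ->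
  sorted run_overlap (g :: gs) ->
  exists R rs, [/\ runs (flatten (g :: gs)) = R :: rs,
    sorted run_overlap (R :: rs), head 0 R = head 0 g & last 0 g <= last 0 R].
Proof.
elim: gs g => [|g' gs IHgs] g.
  rewrite /= andbT cats0 => ng /andP[sg _] _.
  exists g, [::]; split=> //.
  have := @blocks_flatten ltn [:: g].
  by rewrite /= cats0 ng sg; apply.
move=> /andP[ng ngs] /andP[sg sgs] /= /andP[ovg ovgs].
have [R [rs [eqR ovR hR lR]]] := IHgs g' ngs sgs ovgs.
rewrite (_ : g ++ _ = g ++ flatten (g' :: gs)) // (runs_cat_sorted ng sg eqR).
have nR: R != [::].
  have := blocks_nonempty ltn (flatten (g' :: gs)).
  by rewrite -/(runs _) eqR => /andP[].
have sR: sorted ltn R.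
  have := blocks_sorted ltn (flatten (g' :: gs)).
  by rewrite -/(runs _) eqR => /andP[].
case: ltnP => [lt_gR|_]; last first.
  exists g, (R :: rs); split=> //=; move: ovR => /= ->; rewrite andbT.
  by apply: leq_trans lR.
exists (g ++ R), rs; case: g ng sg ovg lt_gR => // x g _ sg ovg lt_gR.
split=> //=; last first.
  rewrite last_cat; case: R nR sR lt_gR {eqR ovR hR lR} => //= y R _ sR lt_gR.
  by apply: leq_trans (ltnW lt_gR) _; apply: sorted_ltn_head_last.
case: rs ovR {eqR} => //= R' rs; rewrite /run_overlap /= => /andP[h ->].
rewrite andbT; apply: leq_ltn_trans h; apply: leq_trans (ltnW lt_gR).
exact: (@sorted_ltn_head_last x).
Qed.

(** For adjacent falls b, b' the last entry of b is below the first of b', strictly because entries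
    are distinct. After reversal this is the overlap of two increasing strings, and merging such
    strings into longer runs preserves it. *)
Lemma flip_overlap s : uniq s -> sorted run_overlap (runs (flip s)).
Proof.
move=> Us; rewrite /flip /falls.
have nb := blocks_nonempty gtn s; have sb := blocks_sorted gtn s.
have ab := blocks_adjacent gtn s; have fb := flatten_blocks gtn s.
move: (blocks gtn s) nb sb ab fb => bs nb sb ab fb; rewrite -{s}fb in Us.
have hrev b : b != [::] -> head 0 (rev b) = last 0 b.
  by case/lastP: b => // b x _; rewrite rev_rcons last_rcons.
have lrev b : b != [::] -> last 0 (rev b) = head 0 b.
  by case: b => // x b _; rewrite rev_cons last_rcons.
have nb' : all (fun g => g != [::]) (map rev bs).
  by rewrite all_map; apply: sub_all nb => b /=; rewrite -!size_eq0 size_rev.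
have sb' : all (sorted ltn) (map rev bs).
  by rewrite all_map; apply: sub_all sb => b /=; rewrite rev_sorted.
have ob : sorted run_overlap (map rev bs).
  elim: bs Us nb ab {sb nb' sb'} => //= b [|b' bs] IHbs //= Us /and3P[nb nb' nbs].
  case/andP=> ab abs; apply/andP; split; last first.
    apply: IHbs => //=; last by rewrite nb'.
    by move: Us; rewrite cat_uniq => /and3P[].
  rewrite /run_overlap hrev ?lrev // ltn_neqAle; move: ab; rewrite /= -leqNgt => ->.
  rewrite andbT; case/lastP: b nb Us {IHbs} => // b x _.
  case: b' nb' {abs} => // y b' _; rewrite last_rcons /= => Us.
  move: Us; rewrite cat_uniq => /and3P[_ /hasPn Us _].
  have := Us y (mem_head _ _); rewrite mem_rcons inE negb_or => /andP[+ _].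
  by rewrite eq_sym.
case: (map rev bs) nb' sb' ob => // g gs nb' sb' ob.
by have [R [rs [-> + _ _]]] := runs_overlap_flatten nb' sb' ob.
Qed.

(** Overlap prevents reversed adjacent runs from joining into one fall, so the falls of the reversed
    word are exactly the reversed runs. *)
Lemma flip_rev_runs s : sorted run_overlap (runs s) ->
  flip (flatten (map rev (runs s))) = s.
Proof.
rewrite /runs => ob; rewrite /flip /falls blocks_flatten.
- rewrite -map_comp (@eq_map _ _ _ id) ?map_id ?flatten_blocks //.
  by move=> b /=; rewrite revK.
- rewrite all_map; apply: sub_all (blocks_nonempty ltn s) => b /=.
  by rewrite -!size_eq0 size_rev.
- rewrite all_map; apply: sub_all (blocks_sorted ltn s) => b /=.
  by rewrite rev_sorted.
move: (blocks ltn s) ob (blocks_nonempty ltn s) => bs.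
elim: bs => //= b [|b' bs] IHbs //= /andP[ob obs] /and3P[nb nb' nbs].
apply/andP; split; last by apply: IHbs => //=; rewrite nb'.
rewrite -leqNgt.
case: b nb ob {IHbs} => // x b _; rewrite /run_overlap /= rev_cons last_rcons.
case/lastP: b' nb' {obs} => // b' y _; rewrite rev_rcons last_rcons /=.
exact: ltnW.
Qed.

(** * Permutations as words *)

Lemma word_perm_eq n (s : 'S_n) : perm_eq (word s) (iota 1 n).
Proof.
have -> : word s = map succn (map val (map s (enum 'I_n))).
  by rewrite /word -!map_comp.
have -> : iota 1 n = map succn (map val (enum 'I_n)).
  by rewrite val_enum_ord -[1]addn0 iotaDl.
do 2!apply: perm_map; apply: uniq_perm; rewrite ?enum_uniq //.
  by rewrite map_inj_uniq ?enum_uniq //; apply: perm_inj.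
move=> i; rewrite mem_enum inE; apply/mapP; exists ((s^-1)%g i).
  by rewrite mem_enum.
by rewrite permKV.
Qed.

Lemma word_inj n : injective (@word n).
Proof.
move=> s t /eq_in_map eqst; apply/permP => i; apply: val_inj.
by have [] := eqst i (mem_enum _ _).
Qed.

Lemma words_of_perms n :
  perm_eq [seq word s | s <- enum 'S_n] (permutations (iota 1 n)).
Proof.
have Us : uniq [seq word s | s <- enum 'S_n].
  by rewrite map_inj_uniq ?enum_uniq //; apply: word_inj.
apply: uniq_perm => //; first exact: permutations_uniq.
have [||_] // := @uniq_min_size _ _ (permutations (iota 1 n)) Us.
  by move=> w /mapP[s _ ->]; rewrite mem_permutations word_perm_eq.
rewrite size_permutations ?iota_uniq // size_map -cardE size_iota.
by rewrite card_Sn.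
Qed.

Lemma word_surj n w : perm_eq w (iota 1 n) -> exists s : 'S_n, word s = w.
Proof.
rewrite -mem_permutations -(perm_mem (words_of_perms n)) => /mapP[s _ ->].
by exists s.
Qed.

Lemma pop_stackedE n (s : 'S_n) :
  pop_stacked s = sorted run_overlap (runs (word s)).
Proof.
apply/existsP/idP => [[t /eqP <-]|ob].
  by apply: flip_overlap; rewrite (perm_uniq (word_perm_eq t)) iota_uniq.
have [|t et] := @word_surj n (flatten (map rev (runs (word s)))).
  apply: perm_trans (word_perm_eq s).
  rewrite -{2}[word s](flatten_blocks ltn) -/(runs _).
  elim: (runs _) => //= b bs IHbs; apply: perm_cat => //.
  by rewrite perm_rev.
by exists t; rewrite et flip_rev_runs.
Qed.

(** * Building permutations by appending a letter *)

Definition append_rel (x : nat) (w : seq nat) := rcons (map (bump x) w) x.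

(* [words m] lists the permutations of size m + 1. *)
Fixpoint words (m : nat) : seq (seq nat) :=
  if m is m'.+1 then [seq append_rel x w | w <- words m', x <- iota 1 m.+1]
  else [:: [:: 1]].

Lemma wordsS m :
  words m.+1 = [seq append_rel x w | w <- words m, x <- iota 1 m.+2].
Proof. by []. Qed.

Lemma bump_inj x : injective (bump x).
Proof. exact: can_inj (bumpK x). Qed.

Lemma ltn_bump2 x y z : (bump x y < bump x z) = (y < z).
Proof. by rewrite /bump; lia. Qed.

Lemma mem_words m w : w \in words m -> perm_eq w (iota 1 m.+1).
Proof.
elim: m w => [|m IHm] w; first by rewrite inE => /eqP ->.
case/allpairsP=> -[w' x] /= [/IHm pw' xin ->].
have Uw' : uniq w' by rewrite (perm_uniq pw') iota_uniq.
have Uw : uniq (append_rel x w').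
  rewrite rcons_uniq map_inj_uniq ?Uw' ?andbT; last exact: bump_inj.
  by apply/mapP => -[y _ /eqP]; rewrite (negbTE (neq_bump _ _)).
have sub : {subset append_rel x w' <= iota 1 m.+2}.
  move=> y; rewrite mem_rcons inE => /predU1P[-> //|/mapP[y' yin ->]].
  by move: yin; rewrite (perm_mem pw') !mem_iota /bump; lia.
have lesz : size (iota 1 m.+2) <= size (append_rel x w').
  by rewrite size_rcons size_map (perm_size pw') !size_iota.
have [_ eqm] := uniq_min_size Uw sub lesz.
exact: uniq_perm Uw (iota_uniq _ _) eqm.
Qed.

Lemma words_uniq m : uniq (words m).
Proof.
elim: m => // m IHm; rewrite wordsS; apply: allpairs_uniq => //.
  exact: iota_uniq.
move=> [w x] [w' x'] _ _ /= /rcons_inj[+ eqx]; rewrite -{}eqx => eqw.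
by congr (_, _); apply: inj_map eqw; apply: bump_inj.
Qed.

Lemma size_words m : size (words m) = (m.+1)`!.
Proof.
elim: m => // m IHm.
by rewrite wordsS size_allpairs IHm size_iota mulnC -factS.
Qed.

(** By counting: [words m] consists of (m + 1)! distinct permutations, hence of all of them. *)
Lemma words_permutations m : perm_eq (permutations (iota 1 m.+1)) (words m).
Proof.
rewrite perm_sym; apply: uniq_perm; rewrite ?words_uniq ?permutations_uniq //.
have [||_] // := @uniq_min_size _ _ (permutations (iota 1 m.+1)) (words_uniq m).
  by move=> w /mem_words; rewrite mem_permutations.
by rewrite size_permutations ?iota_uniq // size_iota size_words.
Qed.

Lemma card_perm_words m (F : pred (seq nat)) :
  #|[set s : 'S_m.+1 | F (word s)]| = count F (words m).
Proof.
rewrite -(seq.permP (words_permutations m) F) -(seq.permP (words_of_perms m.+1) F).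
rewrite count_map -sum1dep_card -sum1_count big_enum_cond /=.
by apply: eq_bigl => s.
Qed.

(* [prev_min] is the minimum of the last run but one, or 0 if there is no    *)
(* such run; [inner_ok] says that all pairs of adjacent runs overlap, except *)
(* possibly the last pair.                                                   *)
Record run_state := RunState {
  nruns : nat; prev_min : nat; run_min : nat; run_snd : nat; run_max : nat;
  inner_ok : bool }.

Definition valid_state (st : run_state) : bool :=
  inner_ok st && (prev_min st < run_max st).

(** [R] is the last run in decreasing order. The default in [run_snd] makes the second largest
    letter equal to the only letter of a singleton run. *)
Definition state_of (w : seq nat) : run_state :=
  let rs := rev (runs w) in
  let R := rev (head [::] rs) in
  RunState (size rs) (head 0 (head [::] (behead rs))) (last 0 R)
    (head (head 0 R) (behead R)) (head 0 R)
    (sorted run_overlap (rev (behead rs))).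

(** Opening a new run makes the old last pair of runs final, so its validity becomes the new
    [inner_ok]. Extending the last run raises its maximum to x, which may turn an invalid state into
    a valid one; this is why [inner_ok] is tracked separately. *)
Definition append_state (x : nat) (st : run_state) : run_state :=
  if run_max st < x then
    RunState (nruns st) (bump x (prev_min st)) (bump x (run_min st))
      (bump x (run_max st)) x (inner_ok st)
  else RunState (nruns st).+1 (bump x (run_min st)) x x x (valid_state st).

Lemma runs_rconsP w : w != [::] ->
  exists rs R y, runs w = rcons rs (rcons R y).
Proof.
rewrite -(blocks_eq0 ltn) -/(runs w); have := blocks_nonempty ltn w.
rewrite -/(runs w); case/lastP: (runs w) => // rs R.
rewrite all_rcons => /andP[]; case/lastP: R => // R y _ _ _.
by exists rs, R, y.
Qed.

Lemma state_of_runs w rs R y : runs w = rcons rs (rcons R y) ->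
  state_of w = RunState (size rs).+1 (head 0 (last [::] rs)) (head y R)
    (last y R) y (sorted run_overlap rs).
Proof.
move=> e; rewrite /state_of e !rev_rcons /= revK size_rev.
congr RunState.
- by case/lastP: rs {e} => //= rs R'; rewrite rev_rcons last_rcons.
- by case: R {e} => //= z R; rewrite rev_cons last_rcons.
- by case/lastP: R {e} => //= R z; rewrite rev_rcons last_rcons.
Qed.

Lemma sorted_overlap_rcons rs R :
  sorted run_overlap (rcons rs R) =
    sorted run_overlap rs && ((rs == [::]) || run_overlap (last [::] rs) R).
Proof. by case: rs => //= R' rs; rewrite rcons_path; congr (_ && _); case: rs. Qed.

Lemma run_max_gt0 w rs R y : runs w = rcons rs (rcons R y) -> 0 \notin w ->
  0 < y.
Proof.
move=> e; rewrite lt0n; apply: contra => /eqP y0.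
rewrite -(flatten_blocks ltn w) -/(runs w) e flatten_rcons mem_cat.
by rewrite mem_rcons y0 mem_head orbT.
Qed.

Lemma valid_state_of w : w != [::] -> 0 \notin w ->
  valid_state (state_of w) = sorted run_overlap (runs w).
Proof.
move=> nw w0; have [rs [R [y e]]] := runs_rconsP nw.
rewrite (state_of_runs e) e sorted_overlap_rcons // /valid_state /=.
congr (_ && _); rewrite /run_overlap last_rcons.
by case: rs e => //= e; rewrite (run_max_gt0 (rs := [::]) e).
Qed.

(** For positive x, [bump x] fixes 0, the default that stands for a missing run. *)
Lemma head0_map_bump x (R : seq nat) : 0 < x ->
  head 0 (map (bump x) R) = bump x (head 0 R).
Proof. by case: R => //=; rewrite /bump; case: x. Qed.

Lemma last0_map_bump x (R : seq nat) : 0 < x ->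
  last 0 (map (bump x) R) = bump x (last 0 R).
Proof. by case: x => // x _; rewrite -[in RHS]last_map. Qed.

Lemma state_of_append w x : w != [::] -> 0 \notin w -> 0 < x ->
  state_of (append_rel x w) = append_state x (state_of w).
Proof.
move=> nw w0 x0; have [rs [R [y e]]] := runs_rconsP nw.
have y0 := run_max_gt0 e w0.
have em : runs (map (bump x) w) =
    rcons (map (map (bump x)) rs) (rcons (map (bump x) R) (bump x y)).
  by rewrite /runs blocks_map -?/(runs w) ?e ?map_rcons //; apply: ltn_bump2.
have ok : sorted run_overlap (map (map (bump x)) rs) = sorted run_overlap rs.
  rewrite sorted_map; case: rs {e em} => //= R1 rs; apply: eq_path => R2 R3 /=.
  by rewrite /run_overlap head0_map_bump // last0_map_bump // ltn_bump2.
have hlast : head 0 (last [::] (map (map (bump x)) rs)) =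
    bump x (head 0 (last [::] rs)).
  by rewrite -head0_map_bump // -(last_map (map (bump x))).
have ltb : (bump x y < x) = (y < x) by rewrite /bump; lia.
have := blocks_rcons x em; rewrite -/(runs _) last_rcons /= ltb.
rewrite /append_state (state_of_runs e) /=.
case: ifP => _ er.
  rewrite (state_of_runs er) size_map ok hlast last_rcons; congr RunState.
  by case: (R).
rewrite (@state_of_runs _ _ [::] x er) size_rcons size_map last_rcons.
congr RunState; first by case: (R).
rewrite sorted_overlap_rcons ok; congr (_ && _).
rewrite /run_overlap last_rcons hlast ltn_bump2.
by case: (rs) => //=; rewrite y0.
Qed.

(** * Statistics of the last run *)

Lemma is_maxE z d S : z \in S -> all (fun x => x <= z) S -> is_max d S = (z == d).
Proof.
move=> zS /allP leS; apply/andP/eqP => [[dS /allP led]|<-]; last first.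
  by split=> //; apply/allP.
by apply/eqP; rewrite eqn_leq leS // led.
Qed.

Lemma is_minE z d S : z \in S -> all (fun x => z <= x) S -> is_min d S = (z == d).
Proof.
move=> zS /allP leS; apply/andP/eqP => [[dS /allP led]|<-]; last first.
  by split=> //; apply/allP.
by apply/eqP; rewrite eqn_leq leS // led.
Qed.

Lemma run_stats_rcons R y a b c : sorted ltn (rcons R y) ->
  run_stats (rcons R y) a b c = [&& head y R == a, last y R == b & y == c].
Proof.
move=> sR; have Uy : y \notin R.
  by have := sorted_uniq ltn_trans ltnn sR; rewrite rcons_uniq => /andP[].
have maxE S z d : sorted ltn (rcons S z) -> is_max d (rcons S z) = (z == d).
  rewrite (sorted_pairwise ltn_trans) pairwise_rcons => /andP[ltS _].
  apply: is_maxE; rewrite ?mem_rcons ?mem_head // all_rcons leqnn /=.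
  by apply: sub_all ltS => x /ltnW.
have minE : is_min a (rcons R y) = (head y R == a).
  apply: is_minE; first by case: (R) => [|x S]; rewrite mem_head.
  case: R sR {Uy} => [|x S] /=; first by rewrite leqnn.
  move/(order_path_min ltn_trans) => ltS; rewrite leqnn.
  by apply: sub_all ltS => z /ltnW.
rewrite /run_stats minE maxE //; case: eqP => //= <-; rewrite andbC.
case: (y =P c) => [<-|]; rewrite ?andbF ?andbT //.
have -> : rem y (rcons R y) = R.
  rewrite rem_filter ?(sorted_uniq ltn_trans ltnn) // filter_rcons /= eqxx /=.
  by apply/all_filterP/allP => x xR /=; apply: contraNneq Uy => <-.
case/lastP: R sR {Uy maxE minE} => [|R x] sR /=; first by rewrite ltnn eq_sym.
have sRx : sorted ltn (rcons R x).
  by move: sR; rewrite -[rcons (rcons R x) y]cats1 => /cat_sorted2[].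
rewrite last_rcons -(@is_maxE x b (rcons R x)); last first.
- move: sRx; rewrite (sorted_pairwise ltn_trans) pairwise_rcons all_rcons leqnn.
  by case/andP=> ltS _; apply: sub_all ltS => z /ltnW.
- by rewrite mem_rcons mem_head.
have -> // : head y (rcons R x) < y.
move: sR; rewrite (sorted_pairwise ltn_trans) pairwise_rcons => /andP[+ _].
by case: (R) => [|z S] /= /andP[].
Qed.

Lemma words_inv m w : w \in words m ->
  [/\ w != [::], 0 \notin w, run_min (state_of w) <= run_max (state_of w)
    & run_max (state_of w) <= m.+1].
Proof.
move=> /mem_words pw.
have nw : w != [::] by rewrite -size_eq0 (perm_size pw) size_iota.
have w0 : 0 \notin w by rewrite (perm_mem pw) mem_iota.
have [rs [R [y e]]] := runs_rconsP nw; rewrite (state_of_runs e) /=; split=> //.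
  have := blocks_sorted ltn w; rewrite -/(runs w) e all_rcons => /andP[+ _].
  case: R {e} => //= x R; have := @sorted_ltn_head_last x (rcons R y).
  by rewrite last_rcons.
have : y \in w.
  by rewrite -(flatten_blocks ltn w) -/(runs w) e flatten_rcons mem_cat
     mem_rcons mem_head orbT.
by rewrite (perm_mem pw) mem_iota => /andP[].
Qed.

Definition state_stats (st : run_state) (k a b c : nat) : bool :=
  [&& valid_state st, nruns st == k, run_min st == a, run_snd st == b
    & run_max st == c].

Lemma p_coefE m k a b c :
  p_coef m.+1 k a b c =
    count (fun w => state_stats (state_of w) k a b c) (words m).
Proof.
rewrite /p_coef.
pose F w := [&& sorted run_overlap (runs w), size (runs w) == k
  & run_stats (last_run w) a b c].
transitivity (count F (words m)).
  rewrite -card_perm_words; congr (#|pred_of_set _|); apply/setP => s.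
  by rewrite !inE pop_stackedE.
apply: eq_in_count => w /words_inv[nw w0 _ _].
rewrite /F /state_stats valid_state_of //; congr (_ && _).
have [rs [R [y e]]] := runs_rconsP nw; rewrite (state_of_runs e) /=.
rewrite /last_run e last_rcons size_rcons; congr (_ && _).
apply: run_stats_rcons.
by have := blocks_sorted ltn w; rewrite -/(runs w) e all_rcons => /andP[].
Qed.

(** * Recursion for the generating polynomials *)

Local Open Scope ring_scope.

Lemma geometric_sum (K : comNzRingType) (x : K) i j : (i <= j)%N ->
  (1 - x) * (\sum_(i <= t < j) x ^+ t) = x ^+ i - x ^+ j.
Proof.
move=> /subnKC <-; elim: (j - i)%N => [|l IHl].
  by rewrite addn0 big_geq // mulr0 subrr.
rewrite addnS big_nat_recr ?leq_addr //= mulrDr IHl exprS; ring.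
Qed.

Section Recursion.
Variable K : comNzRingType.
Implicit Types (u A B C : K) (st : run_state) (m : nat).

Definition run_weight u A B C st : K :=
  if valid_state st then
    u ^+ nruns st * A ^+ run_min st * B ^+ run_snd st * C ^+ run_max st
  else 0.

Definition word_poly m u A B C : K :=
  \sum_(w <- words m) run_weight u A B C (state_of w).

(* [singleton_part] and [extended_part] sum over the permutations of size    *)
(* m + 2 whose last run has one, resp. at least two letters; [pair_part] and *)
(* [long_part] over those of size m + 3 whose last run has exactly two,      *)
(* resp. at least three letters.                                             *)
Definition singleton_weight u W st : K :=
  if valid_state st then
    u ^+ (nruns st).+1 * \sum_((run_min st).+1 <= x < (run_max st).+1) W ^+ x
  else 0.

Definition singleton_part m u W : K :=
  \sum_(w <- words m) singleton_weight u W (state_of w).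

(** Here n is the size of the shorter word, so the new letter x is at most n + 1. Only [inner_ok] is
    required, because the last pair of runs is tested against the new maximum x. *)
Definition ext_weight n u A B C st : K :=
  if inner_ok st then
    u ^+ nruns st * A ^+ run_min st * B ^+ run_max st *
      \sum_((run_max st).+1 <= x < n.+2 | (prev_min st < x)%N) C ^+ x
  else 0.

Definition extended_part m u A B C : K :=
  \sum_(w <- words m) ext_weight m.+1 u A B C (state_of w).

(** The letter b opens a run behind one whose minimum becomes [bump b (run_min st)]; the overlap of
    these two runs is tested only against x. *)
Definition pair_weight n u X Y st : K :=
  if valid_state st then
    u ^+ (nruns st).+1 * \sum_(1 <= b < (run_max st).+1) X ^+ b *
      \sum_(b.+1 <= x < n.+3 | (bump b (run_min st) < x)%N) Y ^+ x
  else 0.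

Definition pair_part m u X Y : K :=
  \sum_(w <- words m) pair_weight m.+1 u X Y (state_of w).

Definition long_weight n u A B C st : K :=
  if inner_ok st then
    u ^+ nruns st * A ^+ run_min st *
    \sum_((run_max st).+1 <= b < n.+2) B ^+ b *
      \sum_(b.+1 <= x < n.+3 | (bump b (prev_min st) < x)%N) C ^+ x
  else 0.

Definition long_part m u A B C : K :=
  \sum_(w <- words m) long_weight m.+1 u A B C (state_of w).

Lemma big_words m (F : run_state -> K) :
  \sum_(w <- words m.+1) F (state_of w) =
  \sum_(w <- words m) \sum_(1 <= x < m.+3) F (append_state x (state_of w)).
Proof.
rewrite wordsS big_allpairs_dep; apply: eq_big_seq => w /words_inv[nw w0 _ _].
rewrite -[index_iota _ _]/(iota 1 m.+2); apply: eq_big_seq => x.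
rewrite mem_iota => /andP[x0 _].
by rewrite state_of_append.
Qed.

(** The last letter x either opens a run (x <= c) or extends one (x > c). In the first case all
    three statistics equal x, whence the product A * B * C. *)
Lemma word_polyS m u A B C :
  word_poly m.+1 u A B C =
    singleton_part m u (A * B * C) + extended_part m u A B C.
Proof.
rewrite /word_poly big_words /singleton_part /extended_part -big_split /=.
apply: eq_big_seq => w /words_inv[_ _]; case: (state_of w) => k d a b c ok;
  rewrite /singleton_weight /ext_weight /=.
move=> le_ac le_cm; rewrite (@big_cat_nat _ _ _ c.+1) //=; last by lia.
congr (_ + _).
  rewrite (eq_big_nat _ _ (F2 := fun x => if valid_state (RunState k d a b c ok)
     && (a < x)%N then u ^+ k.+1 * (A * B * C) ^+ x else 0)); last first.
    move=> x /andP[x1 xc]; rewrite /append_state /= ltnNge -ltnS xc /=.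
    rewrite /run_weight {1}/valid_state /=.
    rewrite (_ : (bump x a < x)%N = (a < x)%N); last by rewrite /bump; lia.
    by case: ifP => // _; rewrite !exprMn !mulrA.
  case: (valid_state _) => /=; last by rewrite big1.
  rewrite (@big_cat_nat _ _ _ a.+1) //= ?ltnS // big_nat_cond big1 ?add0r.
    rewrite mulr_sumr; apply: eq_big_nat => x /andP[ax _].
    by rewrite ifT.
  by move=> x /andP[/andP[_ xa] _]; rewrite ifF //; lia.
rewrite (eq_big_nat _ _ (F2 := fun x => if ok && (d < x)%N then
    u ^+ k * A ^+ a * B ^+ c * C ^+ x else 0)); last first.
  move=> x /andP[cx xm]; rewrite /append_state /= cx /run_weight /valid_state /=.
  rewrite (_ : (bump x d < x)%N = (d < x)%N); last by rewrite /bump; lia.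
  have -> : bump x a = a by rewrite /bump; lia.
  have -> // : bump x c = c by rewrite /bump; lia.
rewrite /ext_weight /=; case: ok => /=; last by rewrite big1.
by rewrite mulr_sumr -big_mkcond.
Qed.

Lemma singleton_partE m u W :
  (1 - W) * singleton_part m u W =
    u * W * (word_poly m u W 1 1 - word_poly m u 1 1 W).
Proof.
rewrite /singleton_part /word_poly -sumrB !mulr_sumr; apply: eq_big_seq => w.
case/words_inv=> _ _; case: (state_of w) => k d a b c ok;
  rewrite /singleton_weight /= => le_ac _.
rewrite /run_weight /=; case: ifP => _; last by ring.
rewrite mulrCA geometric_sum ?ltnS // !expr1n !exprS; ring.
Qed.

Lemma extended_partS m u A B C :
  extended_part m.+1 u A B C = pair_part m u (A * B) C + long_part m u A B C.
Proof.
rewrite /extended_part big_words /pair_part /long_part -big_split /=.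
apply: eq_big_seq => w /words_inv[_ _]; case: (state_of w) => k d a b c ok;
  rewrite /pair_weight /long_weight /=.
move=> le_ac le_cm; rewrite (@big_cat_nat _ _ _ c.+1) //=; last by lia.
congr (_ + _).
  case: ifP => vst; rewrite ?mulr_sumr; last first.
    rewrite big_nat_cond big1 // => x /andP[/andP[_ xc] _].
    by rewrite /append_state /= ltnNge -ltnS xc /= /ext_weight /= vst.
  apply: eq_big_nat => x /andP[_ xc].
  by rewrite /append_state /= ltnNge -ltnS xc /= /ext_weight /= vst exprMn !mulrA.
case: ok => /=; last first.
  rewrite big_nat_cond big1 // => x /andP[/andP[cx _] _].
  by rewrite /append_state /= cx.
rewrite mulr_sumr; apply: eq_big_nat => x /andP[cx _].
rewrite /append_state /= cx /ext_weight /= !mulrA.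
by have -> : bump x a = a by rewrite /bump; lia.
Qed.

(** Removing the second largest letter b leaves an extended run with maximum y = x - 1, and the
    admissible b form the interval c < b <= y, where c is the letter before b. *)
Lemma extended_part_long m u A B C :
  (1 - B) * long_part m u A B C =
    B * C * (extended_part m u A B C - extended_part m u A 1 (B * C)).
Proof.
rewrite /long_part /extended_part -sumrB !mulr_sumr; apply: eq_big_seq => w.
case/words_inv=> _ _; case: (state_of w) => k d a b c ok;
  rewrite /long_weight /= => le_ac le_cm.
rewrite /ext_weight /=; case: ok => /=; last by ring.
set S := (X in (1 - B) * (_ * X)).
(* Substitute x = y + 1 and exchange the sums; since b <= y, the condition [bump b d < y + 1]
   amounts to d < y. *)
have -> : S = \sum_(c.+1 <= y < m.+3 | (d < y)%N)
    C ^+ y.+1 * \sum_(c.+1 <= t < y.+1) B ^+ t.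
  rewrite /S; transitivity (\sum_(c.+1 <= t < m.+3) \sum_(c.+1 <= y < m.+3)
     (if (t <= y)%N && (d < y)%N then B ^+ t * C ^+ y.+1 else 0)).
    apply: eq_big_nat => t /andP[ct tm].
    rewrite big_add1 /= (@big_cat_nat _ _ _ t c.+1) //=; last exact: ltnW.
    rewrite [X in _ = X + _]big_nat_cond [X in _ = X + _]big1 ?add0r.
      rewrite mulr_sumr big_mkcond; apply: eq_big_nat => y /andP[ty _].
      rewrite ty /=; congr (if _ then _ else _); rewrite /bump; lia.
    by move=> y /andP[/andP[_ yt] _]; rewrite ifF //; lia.
  rewrite exchange_big_nat /= [RHS]big_mkcond; apply: eq_big_nat => y /andP[cy ym].
  case: ifP => dy; last by rewrite big1 // => t _; rewrite andbF.
  rewrite (@big_cat_nat _ _ _ y.+1 c.+1) //=; last by lia.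
  rewrite [X in _ + X = _]big_nat_cond [X in _ + X = _]big1 ?addr0.
    rewrite mulr_sumr; apply: eq_big_nat => t /andP[_ ty].
    by rewrite -ltnS ty /= mulrC.
  by move=> t /andP[/andP[ty _] _]; rewrite ifF //; lia.
rewrite expr1n mulr1 mulrCA.
transitivity (u ^+ k * A ^+ a * (B * C *
    (B ^+ c * \sum_(c.+1 <= y < m.+3 | (d < y)%N) C ^+ y
     - \sum_(c.+1 <= y < m.+3 | (d < y)%N) (B * C) ^+ y))); last by ring.
congr (_ * _); rewrite !mulr_sumr -sumrB mulr_sumr.
rewrite big_nat_cond [RHS]big_nat_cond; apply: eq_bigr => y /andP[/andP[cy _] _].
rewrite mulrCA geometric_sum; last exact: ltnW.
rewrite exprMn !exprS; ring.
Qed.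

(** The singleton parts depend only on the product of the three arguments, so they cancel in the
    difference on the right. *)
Lemma long_partE m u A B C :
  (1 - B) * long_part m u A B C =
    B * C * (word_poly m.+1 u A B C - word_poly m.+1 u A 1 (B * C)).
Proof.
rewrite extended_part_long !word_polyS mulr1 (mulrA A); ring.
Qed.

Lemma pair_sum (X Y : K) a c n : (a <= c)%N -> (c <= n)%N ->
  (1 - X) * (1 - Y) * (1 - X * Y) *
    (\sum_(1 <= b < c.+1) X ^+ b * \sum_(b.+1 <= x < n.+3 | (bump b a < x)%N) Y ^+ x)
  = X * Y * (- (X * Y * (1 - Y) * ((X * Y) ^+ a - (X * Y) ^+ c))
     + Y * (1 - X * Y) * (Y ^+ a - (X * Y) ^+ c)
     + Y ^+ 2 * (1 - X * Y) * (Y ^+ n * (X ^+ c - 1))).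
Proof.
move=> le_ac le_cn; rewrite (@big_cat_nat _ _ _ a.+1) //=.
(* For b <= a the raised minimum is a + 1, so x runs from a + 2 to n + 2 whatever b is. *)
have step1 : (1 - Y) * (\sum_(1 <= b < a.+1)
      X ^+ b * \sum_(b.+1 <= x < n.+3 | (bump b a < x)%N) Y ^+ x) =
    (Y ^+ a.+2 - Y ^+ n.+3) * \sum_(1 <= b < a.+1) X ^+ b.
  rewrite !mulr_sumr; apply: eq_big_nat => b /andP[_ ba]; rewrite mulrCA mulrC.
  congr (_ * _); rewrite (@big_cat_nat _ _ _ a.+2) //=; [|lia|lia].
  rewrite big_nat_cond big_pred0 ?add0r.
    rewrite -geometric_sum; last by lia.
    congr (_ * _); rewrite big_nat_cond [RHS]big_nat_cond; apply: eq_bigl => x.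
    by rewrite /bump; lia.
  by move=> x; rewrite /bump; lia.
(* For b > a the minimum is not raised, and x > b already implies the overlap. *)
have step2 : (1 - Y) * (\sum_(a.+1 <= b < c.+1)
      X ^+ b * \sum_(b.+1 <= x < n.+3 | (bump b a < x)%N) Y ^+ x) =
    Y * (\sum_(a.+1 <= b < c.+1) (X * Y) ^+ b)
      - Y ^+ n.+3 * \sum_(a.+1 <= b < c.+1) X ^+ b.
  rewrite !mulr_sumr -sumrB; apply: eq_big_nat => b /andP[ab bc].
  have -> : \sum_(b.+1 <= x < n.+3 | (bump b a < x)%N) Y ^+ x =
      \sum_(b.+1 <= x < n.+3) Y ^+ x.
    rewrite big_nat_cond [RHS]big_nat_cond; apply: eq_bigl => x.
    by rewrite /bump; lia.
  rewrite mulrCA geometric_sum; last by lia.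
  rewrite exprMn !exprS; ring.
have g1 := @geometric_sum K X 1 a.+1 (ltn0Sn _).
have g2 := @geometric_sum K X a.+1 c.+1 le_ac.
have g3 := @geometric_sum K (X * Y) a.+1 c.+1 le_ac.
rewrite mulrDr; set S1 := \sum_(1 <= b < a.+1) _; set S2 := \sum_(a.+1 <= b < _) _.
transitivity ((1 - X) * (1 - X * Y) * ((1 - Y) * S1)
    + (1 - X) * (1 - X * Y) * ((1 - Y) * S2)).
  ring.
rewrite step1 step2.
move: g1 g2 g3; set s1 := \sum_(1 <= b < a.+1) _.
set s2 := \sum_(a.+1 <= b < _) X ^+ _.
set s3 := \sum_(a.+1 <= b < _) _ => g1 g2 g3.
transitivity ((1 - X * Y) * (Y ^+ a.+2 - Y ^+ n.+3) * ((1 - X) * s1)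
   + (1 - X) * Y * ((1 - X * Y) * s3) - (1 - X * Y) * Y ^+ n.+3 * ((1 - X) * s2)).
  ring.
rewrite g1 g2 g3 !exprMn !exprS; ring.
Qed.

Lemma pair_partE m u X Y :
  (1 - X) * (1 - Y) * (1 - X * Y) * pair_part m u X Y =
  u * X * Y * (- (X * Y * (1 - Y) *
       (word_poly m u (X * Y) 1 1 - word_poly m u 1 1 (X * Y)))
     + Y * (1 - X * Y) * (word_poly m u Y 1 1 - word_poly m u 1 1 (X * Y))
     + Y ^+ 2 * (1 - X * Y) *
       (Y ^+ m.+1 * (word_poly m u 1 1 X - word_poly m u 1 1 1))).
Proof.
rewrite /pair_part /word_poly -!sumrB !mulr_sumr -sumrN -!big_split /= mulr_sumr.
apply: eq_big_seq => w /words_inv[_ _].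
case: (state_of w) => k d a b c ok;
  rewrite /pair_weight /= => le_ac le_cm.
rewrite /run_weight /=; case: ifP => _; last by ring.
rewrite mulrCA pair_sum // !expr1n exprS; ring.
Qed.

End Recursion.

Lemma word_poly_rec (K : comUnitRingType) m (u A B C : K) (W := A * B * C) :
  1 - A * B \is a GRing.unit -> 1 - C \is a GRing.unit ->
  1 - W \is a GRing.unit -> 1 - B \is a GRing.unit ->
  word_poly m.+2 u A B C =
    u * W / (1 - W) * (word_poly m.+1 u W 1 1 - word_poly m.+1 u 1 1 W)
    + u * W * (C / (1 - A * B) / (1 - C)
          * (word_poly m u C 1 1 - word_poly m u 1 1 W)
        + C ^+ 2 / (1 - A * B) / (1 - C)
          * (C ^+ m.+1 * (word_poly m u 1 1 (A * B) - word_poly m u 1 1 1))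
        - W / (1 - W) / (1 - A * B)
          * (word_poly m u W 1 1 - word_poly m u 1 1 W))
    + B * C / (1 - B) * (word_poly m.+1 u A B C - word_poly m.+1 u A 1 (B * C)).
Proof.
move=> UX UY UW UB; rewrite word_polyS extended_partS -/W addrA.
have divE (x y z : K) : x \is a GRing.unit -> x * y = z -> y = x^-1 * z.
  by move=> Ux <-; rewrite mulKr.
rewrite (divE _ _ _ UW (singleton_partE m.+1 u W)).
rewrite (divE _ _ _ UB (long_partE m u A B C)).
have UXYW : (1 - A * B) * (1 - C) * (1 - W) \is a GRing.unit.
  by rewrite !unitrM UX UY UW.
rewrite (divE _ _ _ UXYW (pair_partE m u (A * B) C)) -/W.
rewrite !invrM ?unitrM ?UX ?UY ?UW //.
move: (mulVr UX) (mulVr UY) (mulVr UW).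
set iX := (1 - A * B)^-1; set iY := (1 - C)^-1; set iW := (1 - W)^-1 => eX eY eW.
congr (_ + _ + _); first by ring.
  set p := word_poly _ _ _ _ _ - _; set q := word_poly _ _ _ _ _ - _.
  set r := word_poly _ _ _ _ _ - _.
  (* [ring] does not know that iW and iY are inverses, so the factors equal to 1 are displayed. *)
  transitivity (u * W * (C * iX * iY * q * (iW * (1 - W))
     + C ^+ 2 * iX * iY * (C ^+ m.+1 * r) * (iW * (1 - W))
     - W * iW * iX * p * (iY * (1 - C)))); first by rewrite /W; ring.
  by rewrite eW eY !mulr1.
ring.
Qed.

(** * Passing to power series *)

Section PowerSums.
Variables (n : nat) (R : comNzRingType).
Implicit Types (f z c : mfps n R) (Y : nat -> mfps n R) (m : 'X_{1..n}).

Lemma mfps_coefM_small f g d m :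
  (forall m', (mdeg m' < d)%N -> f m' = 0) -> (mdeg m < d)%N -> (f * g) m = 0.
Proof.
move=> f0 ltmd; rewrite mfps_coefM big1 // => -[k1 k2] /= _.
by rewrite f0 ?mul0r //; apply: leq_trans ltmd; apply: bmdeg.
Qed.

(* \sum_k z^k * Y k, which converges when z has no constant coefficient. *)
Definition power_sum z Y : mfps n R :=
  Mfps (fun m => \sum_(k < (mdeg m).+1) (z ^+ k * Y k) m).

(** Since z^k has no terms of degree below k, any cutoff beyond the degree of m gives the same
    coefficient. *)
Lemma power_sum_coef z Y m N : z 0%MM = 0 -> (mdeg m < N)%N ->
  power_sum z Y m = (\sum_(k < N) z ^+ k * Y k) m.
Proof.
move=> z0 ltmN; rewrite mfps_coef_sum /=.
rewrite (big_ord_widen N (fun k => (z ^+ k * Y k) m)) //.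
rewrite big_mkcond; apply: eq_bigr => k _; case: ltnP => // ltmk.
by rewrite -mfps_coefM (@mfps_coefM_small _ _ k) // => m' /mfps_coefX_small->.
Qed.

Lemma power_sumM z f Y : z 0%MM = 0 ->
  power_sum z (fun k => f * Y k) = f * power_sum z Y.
Proof.
move=> z0; apply: mfpsP => m.
transitivity ((f * \sum_(k < (mdeg m).+1) z ^+ k * Y k) m).
  rewrite (@power_sum_coef _ _ _ (mdeg m).+1) // mulr_sumr; congr (mfps_coef _ _).
  by apply: eq_bigr => k _; rewrite mulrCA.
rewrite !mfps_coefM; apply: eq_bigr => -[k1 k2] /= _; congr (_ * _).
by rewrite -power_sum_coef // bmdeg.
Qed.

Lemma power_sumD z Y Y' :
  power_sum z (fun k => Y k + Y' k) = power_sum z Y + power_sum z Y'.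
Proof.
apply: mfpsP => m; rewrite mfps_coefD -big_split; apply: eq_bigr => k _.
by rewrite mulrDr.
Qed.

Lemma power_sumB z Y Y' :
  power_sum z (fun k => Y k - Y' k) = power_sum z Y - power_sum z Y'.
Proof.
apply: mfpsP => m; rewrite mfps_coefD mfps_coefN -sumrB.
by apply: eq_bigr => k _; rewrite mulrBr.
Qed.

Lemma power_sum_recl z Y : z 0%MM = 0 ->
  power_sum z Y = Y 0%N + z * power_sum z (fun k => Y k.+1).
Proof.
move=> z0; apply: mfpsP => m; rewrite -power_sumM // mfps_coefD.
rewrite (@power_sum_coef _ _ _ (mdeg m).+2) // big_ord_recl expr0 mul1r mfps_coefD.
congr (_ + _); rewrite (@power_sum_coef _ _ _ (mdeg m).+1) //.
by congr (mfps_coef _ _); apply: eq_bigr => k _; rewrite exprS mulrA (mulrC z).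
Qed.

Lemma eq_power_sum z Y Y' : Y =1 Y' -> power_sum z Y = power_sum z Y'.
Proof. by move=> /funext ->. Qed.

Lemma power_sum_scale z c Y :
  power_sum (z * c) Y = power_sum z (fun k => c ^+ k * Y k).
Proof.
by apply: mfpsP => m; apply: eq_bigr => k _; rewrite exprMn mulrA.
Qed.

End PowerSums.

(** * The series P as a power sum in z *)

Definition size_gf n (u A B C : mfps 5 int) : mfps 5 int :=
  if n is m.+1 then word_poly m u A B C else 1.

Definition state_expo n (st : run_state) : 'X_{1..5} :=
  [multinom nth 0%N [:: n; nruns st; run_min st; run_snd st; run_max st] i | i < 5].

(** One monomial for each pop-stacked permutation of size n, with repetition, so that coefficients
    of [P_series] are multiplicities in these lists. *)
Definition expos n : seq 'X_{1..5} :=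
  if n is m.+1 then
    [seq state_expo n (state_of w) | w <- words m & valid_state (state_of w)]
  else [:: 0%MM].

Lemma mnm5P (e e' : 'X_{1..5}) :
  (e == e') = [&& e (inord 0) == e' (inord 0), e (inord 1) == e' (inord 1),
    e (inord 2) == e' (inord 2), e (inord 3) == e' (inord 3)
    & e (inord 4) == e' (inord 4)].
Proof.
apply/eqP/idP => [->|/and5P[/eqP e0 /eqP e1 /eqP e2 /eqP e3 /eqP e4]].
  by rewrite !eqxx.
apply/mnmP => i; rewrite -(inord_val i); case: i => -[|[|[|[|[|//]]]]] //.
Qed.

Lemma count_expos n (e : 'X_{1..5}) :
  count_mem e (expos n) = if n == e (inord 0) then
    p_coef (e (inord 0)) (e (inord 1)) (e (inord 2)) (e (inord 3)) (e (inord 4))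
  else 0%N.
Proof.
case: n => [|m] /=.
  rewrite addn0 mnm5P !mnm0E; case: eqP => [<-|] //=.
  by rewrite ![_ == 0%N]eq_sym.
rewrite count_map count_filter; case: eqP => [em|ne]; last first.
  apply/eqP; rewrite -leqn0 leqNgt -has_count; apply/hasPn => w _ /=.
  apply/nandP; left; apply/eqP => eqe; case: ne.
  by rewrite -eqe mnmE inordK.
rewrite -{1}em p_coefE; apply: eq_count => w /=.
by rewrite mnm5P !mnmE !inordK //= /state_stats andbC em eqxx.
Qed.

Lemma count_expos_upto N (e : 'X_{1..5}) : (e (inord 0) <= N)%N ->
  P_series e = (count_mem e (flatten [seq expos n | n <- iota 0 N.+1]))%:Z.
Proof.
move=> leN; congr Posz.
rewrite count_flatten -map_comp sumnE big_map.
have eN : e (inord 0) \in iota 0 N.+1 by rewrite mem_iota.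
rewrite (bigD1_seq _ eN (iota_uniq _ _)) /= count_expos eqxx big1 ?addn0 //.
by move=> n /negbTE ne; rewrite count_expos ne.
Qed.

Lemma sum_expos n (x : 5.-tuple (mfps 5 int)) :
  \sum_(e <- expos n) \prod_(i < 5) tnth x i ^+ e i =
  tnth x (inord 0) ^+ n * size_gf n (tnth x (inord 1)) (tnth x (inord 2))
    (tnth x (inord 3)) (tnth x (inord 4)).
Proof.
have prod5 (e : 'X_{1..5}) : \prod_(i < 5) tnth x i ^+ e i =
    tnth x (inord 0) ^+ e (inord 0) * (tnth x (inord 1) ^+ e (inord 1)
    * tnth x (inord 2) ^+ e (inord 2) * tnth x (inord 3) ^+ e (inord 3)
    * tnth x (inord 4) ^+ e (inord 4)).
  transitivity (\prod_(0 <= i < 5) tnth x (inord i) ^+ e (inord i)).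
    by rewrite big_mkord; apply: eq_bigr => i _; rewrite inord_val.
  by rewrite unlock /= mulr1 !mulrA.
case: n => [|m] /=; first by rewrite big_seq1 prod5 !mnm0E !expr0 !mulr1.
rewrite big_map big_filter /word_poly mulr_sumr big_mkcond.
apply: eq_bigr => w _; rewrite /run_weight; case: ifP => _; last by rewrite mulr0.
by rewrite prod5 !mnmE !inordK.
Qed.

(** At m only sizes up to the degree of m contribute, because the series put for z has no constant
    term. Each size has finitely many permutations, so the sum has finite support even when other
    arguments are 1. *)
Lemma mfps_substE (x : 5.-tuple (mfps 5 int)) : tnth x (inord 0) 0%MM = 0 ->
  mfps_subst P_series x = power_sum (tnth x (inord 0)) (fun n =>
    size_gf n (tnth x (inord 1)) (tnth x (inord 2)) (tnth x (inord 3))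
      (tnth x (inord 4))).
Proof.
move=> z0; apply: mfpsP => m.
rewrite -[LHS]/(\sum_(e \in [set: 'X_{1..5}]%classic)
  P_series e * (\prod_(i < 5) tnth x i ^+ e i) m).
set N := mdeg m; set L := flatten [seq expos n | n <- iota 0 N.+1].
pose mon (e : 'X_{1..5}) := \prod_(i < 5) tnth x i ^+ e i.
have leL e : e \in L -> (e (inord 0) <= N)%N.
  case/flatten_mapP=> n; rewrite mem_iota add0n ltnS => /andP[_ leN].
  by rewrite -has_pred1 has_count count_expos; case: eqP => // <-.
rewrite (fsbigE (undup L)) ?undup_uniq //; last first.
  move=> e _; rewrite mem_undup => eL; have [leN|ltN] := leqP (e (inord 0)) N.
    by rewrite (count_expos_upto leN) (count_memPn eL) mul0r.
  rewrite (bigD1 (inord 0)) // (@mfps_coefM_small _ _ _ _ (e (inord 0))) ?mulr0 //.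
  by move=> m' ltm; rewrite mfps_coefX_small.
(* A sum over distinct exponents weighted by multiplicity is the plain sum over the list, which
   regroups by size. *)
transitivity (\sum_(e <- undup L) mon e m *+ count_mem e L).
  rewrite big_seq_cond [RHS]big_seq_cond; apply: eq_big => e.
    by rewrite in_setT.
  rewrite mem_undup => /andP[eL _]; rewrite (count_expos_upto (leL _ eL)).
  by rewrite -natz mulr_natl.
rewrite big_undup_iterop_count /L big_flatten big_map.
rewrite -[iota 0 _]/(index_iota 0 N.+1) big_mkord; apply: eq_bigr => n _.
by rewrite -mfps_coef_sum sum_expos.
Qed.

Lemma P_power_sum (Z u A B C : mfps 5 int) : Z 0%MM = 0 ->
  P Z u A B C = power_sum Z (fun n => size_gf n u A B C).
Proof.
move=> Z0; have tnthE j : (j < 5)%N ->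
    tnth [tuple Z; u; A; B; C] (inord j) = nth 0 [:: Z; u; A; B; C] j.
  by move=> j5; rewrite (tnth_nth 0) inordK.
by rewrite /P mfps_substE !tnthE.
Qed.

Lemma word_poly0 (K : comNzRingType) (u A B C : K) :
  word_poly 0 u A B C = u * (A * B * C).
Proof. by rewrite /word_poly big_seq1 /run_weight /= !expr1 !mulrA. Qed.

Lemma word_poly1 (K : comNzRingType) (u A B C : K) :
  word_poly 1 u A B C = u * (A * B) * C ^+ 2.
Proof.
rewrite /word_poly (_ : words 1 = [:: [:: 2; 1]; [:: 1; 2]]%N) //.
by rewrite !big_cons big_nil /run_weight /= add0r addr0 !expr1 !mulrA.
Qed.

Lemma mfpsX_coef0 n (R : comNzRingType) (i : 'I_n) :
  (mfpsX i : mfps n R) 0%MM = 0.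
Proof. by rewrite /= eq_sym mnm1_eq0. Qed.

Lemma mfps_unit1B n (R : comUnitRingType) (f : mfps n R) :
  f 0%MM = 0 -> 1 - f \is a GRing.unit.
Proof.
move=> f0; rewrite -[_ \is a _]/((1 - f) 0%MM \is a GRing.unit).
by rewrite mfps_coefD mfps_coefN mfps_coef1 eqxx f0 subr0 unitr1.
Qed.

Lemma mfps_coefM0r n (R : comNzRingType) (f g : mfps n R) :
  f 0%MM = 0 -> (f * g) 0%MM = 0.
Proof. by move=> f0; rewrite mfps_coefM0 f0 mul0r. Qed.

Theorem theorem10 :
  let z  : mfps 5 int := mfpsX (inord 0) in
  let u  : mfps 5 int := mfpsX (inord 1) in
  let v1 : mfps 5 int := mfpsX (inord 2) in
  let v2 : mfps 5 int := mfpsX (inord 3) in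
  let v3 : mfps 5 int := mfpsX (inord 4) in
  P z u v1 v2 v3 =
    1 + z * u * v1 * v2 * v3 + z ^+ 2 * u * v1 * v2 * v3 ^+ 2
    + (z * u * v1 * v2 * v3) / (1 - v1 * v2 * v3)
      * (1 - (z * v1 * v2 * v3) / (1 - v1 * v2))
      * (P z u (v1 * v2 * v3) 1 1 - P z u 1 1 (v1 * v2 * v3))
    + (z ^+ 2 * u * v1 * v2 * v3 ^+ 2) / ((1 - v1 * v2) * (1 - v3))
      * (P z u v3 1 1 - P z u 1 1 (v1 * v2 * v3))
    + (z ^+ 2 * u * v1 * v2 * v3 ^+ 3) / ((1 - v1 * v2) * (1 - v3))
      * (P (z * v3) u 1 1 (v1 * v2) - P (z * v3) u 1 1 1)
    + (z * v2 * v3) / (1 - v2)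
      * (P z u v1 v2 v3 - P z u v1 1 (v2 * v3)).
Proof.
move=> z u v1 v2 v3; have z0 : z 0%MM = 0 := mfpsX_coef0 _ _.
have v10 : v1 0%MM = 0 := mfpsX_coef0 _ _.
have UX : 1 - v1 * v2 \is a GRing.unit by apply/mfps_unit1B/mfps_coefM0r.
have UW : 1 - v1 * v2 * v3 \is a GRing.unit.
  by apply/mfps_unit1B/mfps_coefM0r/mfps_coefM0r.
have UB : 1 - v2 \is a GRing.unit by apply/mfps_unit1B/mfpsX_coef0.
have UY : 1 - v3 \is a GRing.unit by apply/mfps_unit1B/mfpsX_coef0.
clearbody z u v1 v2 v3.
(* [word_poly m] concerns size m + 1, so [S k] is the series from size k + 1 on, divided by z^(k +
   1). [T] plays the role of [S 0] for the argument z v3. *)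
pose S k A B C := power_sum z (fun n => word_poly (n + k) u A B C).
pose T A B C := power_sum z (fun n => v3 ^+ n.+1 * word_poly n u A B C).
have SE k A B C : S k A B C = word_poly k u A B C + z * S k.+1 A B C.
  rewrite /S power_sum_recl // add0n; congr (_ + z * _); apply: eq_power_sum => n.
  by rewrite addSnnS.
have PE A B C : P z u A B C = 1 + z * S 0 A B C.
  rewrite P_power_sum // power_sum_recl //; congr (_ + z * _).
  by apply: eq_power_sum => n; rewrite addn0.
have TE A B C : P (z * v3) u A B C = 1 + z * T A B C.
  rewrite P_power_sum ?mfps_coefM0r // power_sum_scale power_sum_recl //.
  by rewrite expr0 mul1r.
set W := v1 * v2 * v3.
have S2E : S 2 v1 v2 v3 =
    u * W / (1 - W) * (S 1 W 1 1 - S 1 1 1 W)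
    + u * W * (v3 / (1 - v1 * v2) / (1 - v3) * (S 0 v3 1 1 - S 0 1 1 W)
        + v3 ^+ 2 / (1 - v1 * v2) / (1 - v3) * (T 1 1 (v1 * v2) - T 1 1 1)
        - W / (1 - W) / (1 - v1 * v2) * (S 0 W 1 1 - S 0 1 1 W))
    + v2 * v3 / (1 - v2) * (S 1 v1 v2 v3 - S 1 v1 1 (v2 * v3)).
  have SM f k A B C A' B' C' : power_sum z (fun n =>
      f * (word_poly (n + k) u A B C - word_poly (n + k) u A' B' C')) =
      f * (S k A B C - S k A' B' C').
    by rewrite power_sumM // power_sumB.
  transitivity (power_sum z (fun n =>
      u * W / (1 - W) * (word_poly (n + 1) u W 1 1 - word_poly (n + 1) u 1 1 W)
    + u * W * (v3 / (1 - v1 * v2) / (1 - v3)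
          * (word_poly (n + 0) u v3 1 1 - word_poly (n + 0) u 1 1 W)
        + v3 ^+ 2 / (1 - v1 * v2) / (1 - v3)
          * (v3 ^+ n.+1 * (word_poly n u 1 1 (v1 * v2) - word_poly n u 1 1 1))
        - W / (1 - W) / (1 - v1 * v2)
          * (word_poly (n + 0) u W 1 1 - word_poly (n + 0) u 1 1 W))
    + v2 * v3 / (1 - v2)
        * (word_poly (n + 1) u v1 v2 v3 - word_poly (n + 1) u v1 1 (v2 * v3)))).
    by apply: eq_power_sum => n; rewrite addn2 addn1 addn0 word_poly_rec.
  apply: etrans (power_sumD _ _ _) _; congr (_ + _); last exact: SM.
  apply: etrans (power_sumD _ _ _) _; congr (_ + _); first exact: SM.
  apply: etrans (power_sumM _ _ z0) _; congr (_ * _).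
  apply: etrans (power_sumB _ _ _) _; congr (_ - _); last exact: SM.
  apply: etrans (power_sumD _ _ _) _; congr (_ + _); first exact: SM.
  apply: etrans (power_sumM _ _ z0) _; congr (_ * _).
  rewrite -power_sumB; apply: eq_power_sum => n; exact: mulrBr.
clearbody S T.
(* The size-one polynomial u A B C depends only on the product, so it drops out of the
   difference. *)
have SB A B C A' B' C' : A * B * C = A' * B' * C' ->
    S 0 A B C - S 0 A' B' C' = z * (S 1 A B C - S 1 A' B' C').
  move=> e; rewrite (SE 0%N) (SE 0%N A') !word_poly0 e.
  by rewrite opprD addrACA subrr add0r -mulrBr.
have dE a b : (1 + z * a) - (1 + z * b) = z * (a - b) by ring.
rewrite !PE !TE !dE invrM // (SB v1 v2 v3 v1 1 (v2 * v3)); last first.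
  by rewrite mulr1 mulrA.
(* Splitting off sizes 1 and 2 gives the explicit terms; the recursion applies from size 3 on. *)
have := SE 0%N v1 v2 v3.
rewrite [in X in _ = X](SE 1%N) word_poly0 word_poly1 S2E => ->.
rewrite (SB W 1 1 1 1 W); last by rewrite !mulr1 mul1r.
rewrite /W; ring.
Qed.
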